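(* For every integer $k\ge2$, integers in the interval $[1,k-1]$ cannot be modes of the Poisson distribution of order $k$; that is, for every $\lambda>0$ and every integer $n$ with $1\le n\le k-1$, $n$ is not a mode of the Poisson distribution of order $k$ with parameter $\lambda$. In particular, the value $1$ is never a mode for any $k\ge2$.
   Context: For an integer $k\ge1$ and a real $\lambda>0$, the Poisson distribution of order $k$ with parameter $\lambda$ is the distribution on $\{0,1,2,\dots\}$ with probability mass function $$f_k(n;\lambda)=e^{-k\lambda}\sum_{n_1+2n_2+\dots+kn_k=n}\frac{\lambda^{n_1+\dots+n_k}}{n_1!\cdots n_k!},\qquad n=0,1,2,\dots,$$ where the sum is over all tuples $(n_1,\dots,n_k)$ of nonnegative integers with $n_1+2n_2+\dots+kn_k=n$. A mode is a location of a global maximum of $n\mapsto f_k(n;\lambda)$ over $n\ge0$; modes need not be unique. *)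

(* Defs.v *)
From HB Require Import structures.
From mathcomp Require Import all_boot all_order all_algebra.
From mathcomp Require Import all_classical all_reals all_analysis.

Set Implicit Arguments.
Unset Strict Implicit.
Unset Printing Implicit Defensive.

Import Order.TTheory GRing.Theory Num.Theory.

Local Open Scope ring_scope.

(* The component [t i], for [i : 'I_k], is the multiplicity n_(i+1), so
   the constraint n_1 + 2 n_2 + ... + k n_k = n carries the weight [i.+1].
   Every solution in nonnegative integers has all components at most [n]
   (lemma [weight_bound]), so ranging over ['I_n.+1]-valued tuples omits no
   solution. *)
Definition poisson_order_pmf (R : realType) (k : nat) (lambda : R) (n : nat) : R :=
  expR (- (k%:R * lambda)) *
  \sum_(t : {ffun 'I_k -> 'I_n.+1} | (\sum_(i < k) i.+1 * t i)%N == n)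
     (lambda ^+ (\sum_(i < k) t i)%N / (\prod_(i < k) (t i)`!)%N%:R).

Lemma weight_bound (k n : nat) (t : 'I_k -> nat) :
  (\sum_(i < k) i.+1 * t i)%N = n -> forall i, (t i <= n)%N.
Proof.
move=> <- i; rewrite (bigD1 i) //=.
exact: leq_trans (leq_pmull _ (ltn0Sn i)) (leq_addr _ _).
Qed.

Definition is_mode (R : realType) (f : nat -> R) (n : nat) : Prop :=
  forall m : nat, f m <= f n.

(* Main.v *)
Require Import Defs.
From HB Require Import structures.
From mathcomp Require Import all_boot all_order all_algebra.
From mathcomp Require Import all_classical all_reals all_analysis.
From mathcomp Require Import zify.

Import Order.TTheory GRing.Theory Num.Theory.

Local Open Scope ring_scope.

(** View a solution of n_1 + 2 n_2 + ... + k n_k = n as a partition of n with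
    parts at most k. When 1 <= n < k, enlarging one copy of the largest part
    by 1 maps partitions of n injectively to partitions of n + 1: the number
    of parts is preserved and the product of the n_i! does not increase, so no
    term of the sum decreases. The partition 1 + ... + 1 of n + 1 is not in
    the image, hence the mass at n + 1 is strictly larger than at n. *)

Definition weight {k : nat} (t : 'I_k -> nat) : nat := (\sum_(i < k) i.+1 * t i)%N.

(** Indices start at 0, so the largest part has size [(top t).+1]. The empty partition gets the
    default value 0, which the assumption [0 < weight t] excludes below. *)
Definition top {k : nat} (t : 'I_k -> nat) : nat := (\max_(i < k | t i != 0) i)%N.

(** Positions are compared as natural numbers: if [(top t).+1] were equal to [k], the enlarged part
    would be lost. The bound [weight t < k] prevents this. *)
Definition raise_top {k : nat} (t : 'I_k -> nat) (i : 'I_k) : nat :=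
  (t i - (i == top t :> nat) + (i == (top t).+1 :> nat))%N.

Section RaiseTop.
Local Open Scope nat_scope.
Context {k : nat}.
Implicit Types t u : 'I_k -> nat.

Lemma top_gt0 t (i : 'I_k) : top t < i -> t i = 0.
Proof.
move=> lt_i; apply/eqP; apply: contraLR lt_i => ti; rewrite -leqNgt.
exact: (leq_bigmax_cond (F := fun i : 'I_k => nat_of_ord i)).
Qed.

Lemma top_eq t (m : 'I_k) :
  t m != 0 -> (forall i : 'I_k, m < i -> t i = 0) -> top t = m.
Proof.
move=> tm t0; apply/eqP; rewrite eqn_leq; apply/andP; split.
  apply/bigmax_leqP => i ti; rewrite leqNgt; apply: contra ti => /t0 ->; exact: eqxx.
exact: (leq_bigmax_cond (F := fun i : 'I_k => nat_of_ord i)).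
Qed.

Lemma top_attained t : 0 < weight t -> exists2 m : 'I_k, top t = m & t m != 0.
Proof.
move=> wt; have [i ti] : exists i, t i != 0.
  apply/existsP; apply: contraLR wt => /existsPn t0.
  by rewrite -leqNgt leqn0 /weight big1 // => i _; move/negbNE/eqP: (t0 i) ->; rewrite muln0.
have [|m tm tE] := @eq_bigmax_cond _ [pred i | t i != 0] (fun i : 'I_k => nat_of_ord i).
  by apply/card_gt0P; exists i.
by exists m => //; rewrite -tE.
Qed.

(** A single copy of the largest part already contributes [(top t).+1] to the weight. *)
Lemma top_lt_weight t : 0 < weight t -> top t < weight t.
Proof.
move=> /top_attained[m -> tm]; rewrite /weight (bigD1 m) //=.
by apply: leq_trans (leq_addr _ _); rewrite leq_pmulr // lt0n.
Qed.

(** Reduces [raise_top] to a change at two adjacent positions; [m'] lies above the top, so its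
    multiplicity goes from 0 to 1. *)
Lemma raise_topP t : 0 < weight t < k -> exists m m' : 'I_k,
  [/\ top t = m, m' = m.+1 :> nat, t m != 0, t m' = 0 &
   [/\ raise_top t m = (t m).-1, raise_top t m' = 1 &
       forall i, i != m -> i != m' -> raise_top t i = t i]].
Proof.
move=> /andP[wt0 wtk]; have [m tE tm] := top_attained t wt0.
have ltmk : m.+1 < k by rewrite -tE (leq_ltn_trans (top_lt_weight t wt0)).
exists m, (Ordinal ltmk).
have tm' : t (Ordinal ltmk) = 0 by apply: top_gt0; rewrite tE /=.
split=> //; split; rewrite /raise_top tE /=.
- by rewrite eqxx ltn_eqF // addn0 subn1.
- by rewrite tm' eqxx.
- by move=> i; rewrite -!val_eqE /= => /negbTE -> /negbTE ->; rewrite subn0 addn0.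
Qed.

Lemma weight_raise_top t : 0 < weight t < k -> weight (raise_top t) = (weight t).+1.
Proof.
move=> /raise_topP[m [m' [_ m'E tm tm' [rm rm' ri]]]].
have nm : m' != m by rewrite -val_eqE /= m'E; lia.
rewrite /weight (bigD1 m) // (bigD1 m') //= [in RHS](bigD1 m) //.
rewrite [in RHS](bigD1 m') //= rm rm' tm' m'E.
rewrite (eq_bigr (fun i : 'I_k => i.+1 * t i)); last first.
  by move=> i /andP[im im']; rewrite ri.
by rewrite -[in RHS](prednK (n := t m)) ?lt0n //; lia.
Qed.

Lemma sum_raise_top t : 0 < weight t < k ->
  \sum_(i < k) raise_top t i = \sum_(i < k) t i.
Proof.
move=> /raise_topP[m [m' [_ m'E tm tm' [rm rm' ri]]]].
have nm : m' != m by rewrite -val_eqE /= m'E; lia.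
rewrite (bigD1 m) // (bigD1 m') //= [in RHS](bigD1 m) //.
rewrite [in RHS](bigD1 m') //= rm rm' tm' (eq_bigr t); last first.
  by move=> i /andP[im im']; rewrite ri.
by rewrite addnA addn1 prednK ?lt0n.
Qed.

(** At [m] the factorial can only drop, and at [m'] it stays 1 because 0! = 1!. *)
Lemma prod_fact_raise_top t : 0 < weight t < k ->
  \prod_(i < k) (raise_top t i)`! <= \prod_(i < k) (t i)`!.
Proof.
move=> /raise_topP[m [m' [_ m'E tm tm' [rm rm' ri]]]].
have nm : m' != m by rewrite -val_eqE /= m'E; lia.
rewrite (bigD1 m) // (bigD1 m') //= [leqRHS](bigD1 m) //.
rewrite [X in _ <= _ * X](bigD1 m') //= rm rm' tm'.
rewrite (eq_bigr (fun i => (t i)`!)); last first.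
  by move=> i /andP[im im']; rewrite ri.
by rewrite leq_mul // leq_fact // leq_pred.
Qed.

Lemma top_raise_top t : 0 < weight t < k -> top (raise_top t) = (top t).+1.
Proof.
move=> /raise_topP[m [m' [tE m'E tm tm' [rm rm' ri]]]].
rewrite tE -m'E; apply: top_eq => [|i]; first by rewrite rm'.
rewrite m'E => lt_i; have lt_mi : m < i by exact: ltnW.
have im : i != m by rewrite -val_eqE /= gtn_eqF.
have im' : i != m' by rewrite -val_eqE /= m'E gtn_eqF.
by rewrite (ri i im im') top_gt0 ?tE.
Qed.

(** By [top_raise_top] the image determines the old top, hence the two changed positions. The old
    multiplicity at [m] is one more than the new one, and at [m'] it was 0. *)
Lemma raise_top_inj t u : 0 < weight t < k -> 0 < weight u < k ->
  raise_top t =1 raise_top u -> t =1 u.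
Proof.
move=> wt wu eq_tu.
have topE : top t = top u.
  apply: succn_inj; rewrite -!top_raise_top //.
  by apply: eq_bigl => i; rewrite eq_tu.
have [m [m' [tE m'E tm tm' [rm rm' rt]]]] := raise_topP t wt.
have [p [p' [uE p'E up up' [rp rp' ru]]]] := raise_topP u wu.
have pm : p = m by apply: val_inj; rewrite /= -uE -tE.
have pm' : p' = m' by apply: val_inj; rewrite /= m'E p'E pm.
rewrite {}pm {}pm' in up up' rp rp' ru * => i.
have [->|im] := eqVneq i m.
  by rewrite -(prednK (n := t m)) ?lt0n // -rm eq_tu rp prednK ?lt0n.
have [->|im'] := eqVneq i m'; first by rewrite tm' up'.
by rewrite -rt // eq_tu ru.
Qed.

End RaiseTop.

Lemma poisson_order_pmf_lt (R : realType) (k : nat) (lambda : R) (n : nat) :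
  0 < lambda -> (0 < n < k)%N ->
  poisson_order_pmf k lambda n < poisson_order_pmf k lambda n.+1.
Proof.
move=> lambda0 nk; rewrite /poisson_order_pmf ltr_pM2l ?expR_gt0 //.
(* The truncation by [inord] is harmless on [P]: an image of weight n + 1 has all multiplicities at
   most n + 1, as [phiE] checks. *)
pose phi (t : {ffun 'I_k -> 'I_n.+1}) : {ffun 'I_k -> 'I_n.+2} :=
  [ffun i => inord (raise_top (fun j => t j) i)].
pose P := [set t : {ffun 'I_k -> 'I_n.+1} | weight (fun i => t i) == n].
have wP t : t \in P -> (0 < weight (fun i => t i) < k)%N by rewrite inE => /eqP ->.
have phiE t i : t \in P -> phi t i = raise_top (fun j => t j) i :> nat.
  move=> tP; rewrite ffunE inordK // ltnS; apply: weight_bound.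
  by apply: etrans (weight_raise_top _ (wP _ tP)) _; move: tP; rewrite inE => /eqP ->.
have phi_inj : {in P &, injective phi}.
  move=> t u tP uP tu; apply/ffunP => i; apply: val_inj => /=.
  apply: (raise_top_inj (fun i => t i) (fun i => u i)); rewrite ?wP // => j.
  by rewrite -!phiE // tu.
set F := fun u : {ffun 'I_k -> 'I_n.+2} => lambda ^+ (\sum_(i < k) u i)%N /
  (\prod_(i < k) (u i)`!)%N%:R.
have F0 u : 0 < F u.
  by rewrite divr_gt0 ?exprn_gt0 // ltr0n prodn_gt0 // => i; rewrite fact_gt0.
have k0 : (0 < k)%N by lia.
(* The partition of n + 1 into ones: here [ord_max] is n + 1, placed at index 0. *)
pose u0 : {ffun 'I_k -> 'I_n.+2} :=
  [ffun i => if i == Ordinal k0 then ord_max else ord0].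
have u0Q : weight (fun i => u0 i) == n.+1.
  rewrite /weight (bigD1 (Ordinal k0)) //= big1; last first.
    by move=> i i0; rewrite ffunE (negbTE i0) muln0.
  by rewrite ffunE eqxx /= mul1n addn0.
(* Any image has multiplicity 1 at the positive index [m'], where [u0] vanishes. *)
have u0phi : u0 \notin phi @: P.
  apply/negP => /imsetP[t tP u0E].
  have [m [m' [_ m'E _ _ [_ rm' _]]]] := raise_topP (fun i => t i) (wP t tP).
  by move: rm'; rewrite -phiE // -u0E ffunE -val_eqE /= m'E.
(* The sum for n + 1 splits into the image of [phi], compared with the sum for n, and the rest,
   positive thanks to [u0]. *)
rewrite [ltRHS](bigID (mem (phi @: P))) /= -[ltLHS]addr0 ler_ltD //; last first.
  rewrite (bigD1 u0) /=; last by rewrite u0phi andbT.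
  by rewrite ltr_pwDl ?F0 // sumr_ge0 // => u _; exact/ltW/F0.
(* Images have weight n + 1, so this part runs over the whole image and, by injectivity, is
   reindexed by [P]. *)
rewrite [leRHS](eq_bigl (mem (phi @: P))); last first.
  move=> u /=; apply: andb_idl => /imsetP[t tP ->].
  under eq_bigr => i _ do rewrite phiE //.
  apply/eqP; apply: etrans (weight_raise_top _ (wP _ tP)) _.
  by move: tP; rewrite inE => /eqP ->.
rewrite big_imset //= [leLHS](eq_bigl (mem P)); last by move=> t; rewrite /= inE.
apply: ler_sum => t tP.
have sumE : (\sum_(i < k) phi t i = \sum_(i < k) t i)%N.
  rewrite -(sum_raise_top _ (wP t tP)); apply: eq_bigr => i _; exact: phiE.
have prod_le : (\prod_(i < k) (phi t i)`! <= \prod_(i < k) (t i)`!)%N.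
  apply: leq_trans (prod_fact_raise_top _ (wP t tP)).
  by rewrite leq_eqVlt; apply/orP; left; apply/eqP/eq_bigr => i _; rewrite phiE.
(* The powers of [lambda] agree, so only the denominators remain to be compared. *)
rewrite /F sumE ler_pM2l ?exprn_gt0 // lef_pV2 ?ler_nat //;
  by rewrite posrE ltr0n prodn_gt0 // => i; rewrite fact_gt0.
Qed.

Theorem mainTheorem4 (R : realType) (k : nat) (hk : (2 <= k)%N)
    (lambda : R) (hlambda : 0 < lambda) :
  (forall n : nat, (1 <= n <= k - 1)%N ->
     ~ is_mode (poisson_order_pmf k lambda) n) /\
  ~ is_mode (poisson_order_pmf k lambda) 1%N.
Proof.
have nmode n : (1 <= n <= k - 1)%N -> ~ is_mode (poisson_order_pmf k lambda) n.
  (* The value at n + 1 beats the one at n, including the boundary case n = k - 1. *)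
  move=> hn /(_ n.+1); apply/negP; rewrite -ltNge.
  by apply: poisson_order_pmf_lt => //; lia.
by split=> //; apply: nmode; lia.
Qed.
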